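(* Let $H$ be a Hilbert space over $\mathbf K\in\{\mathbb R,\mathbb C\}$ and let $\mathcal S$ be the normed algebra of all finite rank bounded operators on $H$. The set $B\mathscr L(\mathcal S)$ of all bounded normal cones in the category $\mathscr L(\mathcal S)$ of principal left ideals of $\mathcal S$ is a normed algebra, and it is isomorphic to the normed algebra $\mathcal S$.
   Context: Composition convention: operators and morphisms are composed left to right, i.e. the product is $(T_1T_2)(x)=T_2(T_1(x))$, and $fg$ means first $f$, then $g$. $\mathcal S$ carries the operator norm. For a finite-dimensional subspace $M$ of $H$, $P_M$ is the orthogonal projection of $H$ onto $M$; $R(T)$ is the range of $T$. Category $\mathscr L(\mathcal S)$: objects are the principal left ideals $\mathcal SP=\{AP:A\in\mathcal S\}$ with $P\in\mathcal S$ idempotent; every object equals $\mathcal SP_M$ for a unique finite-dimensional subspace $M$ of $H$. Morphisms $\mathcal SP_1\to\mathcal SP_2$ are the maps $\rho(P_1,T,P_2):A\mapsto AT$ for $T\in P_1\mathcal SP_2$. Inclusions are the set inclusions. For $T\in P_M\mathcal SP_N$ the norm of $\rho(P_M,T,P_N)$ is $\|T\|$. A retraction is a morphism $q$ with $jq=1$ for some inclusion $j$. A cone $\gamma$ with vertex $d$ assigns to each object $c$ a morphism $\gamma(c):c\to d$ such that $j\gamma(c)=\gamma(c')$ for every inclusion $j:c'\to c$; its vertex is denoted $c_\gamma$. It is a normal cone if $\gamma(c)$ is an isomorphism for at least one object $c$. A normal cone $\gamma$ is bounded if there is $\alpha_\gamma\in\mathbb R$ with $\|\gamma(c)\|\le\alpha_\gamma$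 for all objects $c$. A normal factorization of a morphism $f$ is $f=quj$ with $q$ a retraction, $u$ an isomorphism, $j$ an inclusion; $f^\circ=qu$ is the epimorphic component of $f$. Normal cones are multiplied by $(\gamma\cdot\sigma)(c)=\gamma(c)(\sigma(c_\gamma))^\circ$. For $T\in\mathcal S$ with $N=R(T)$, the principal cone $\rho^T$ is the cone with vertex $\mathcal SP_N$ given by $\rho^T(\mathcal SP_M)=\rho(P_M,P_MT,P_N)$. The structure on $B\mathscr L(\mathcal S)$: multiplication is the product of normal cones, and $\rho^{T_1}+\rho^{T_2}=\rho^{T_1+T_2}$, $k\rho^{T}=\rho^{kT}$, $\|\rho^{T}\|=\|T\|$ for $T,T_1,T_2\in\mathcal S$, $k\in\mathbf K$. It is part of the claim that these operations are well defined on $B\mathscr L(\mathcal S)$, i.e. that every bounded normal cone is $\rho^T$ for a unique $T\in\mathcal S$. An isomorphism of normed algebras is a bijective, linear, multiplicative, norm-preserving map. *)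

(* Defs.v *)
From HB Require Import structures.
From mathcomp Require Import all_boot all_order all_algebra.
From mathcomp Require Import complex.
From mathcomp Require Import boolp classical_sets functions reals topology.
From mathcomp Require Import normedtype.
Set Implicit Arguments.
Unset Strict Implicit.
Unset Printing Implicit Defensive.
Import Order.TTheory GRing.Theory Num.Theory.
Import numFieldNormedType.Exports.
Local Open Scope classical_set_scope.
Local Open Scope ring_scope.

(* The ground field R or C, each with its conjugation.  Norms take values in
   the ground field itself, as in normedModType; in R[i] one has a <= b iff
   b - a is a nonnegative real. *)
Inductive ground := RealField | ComplexField.

Definition scalars (R : realType) (k : ground) : numFieldType :=
  match k with RealField => R | ComplexField => R[i] end.

Definition scalar_conj (R : realType) (k : ground) : scalars R k -> scalars R k :=
  match k with RealField => idfun | ComplexField => @conjc R end.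

(* The inner product is linear in its first argument. *)
Record hilbertType (K : numFieldType) (theta : K -> K) := HilbertType {
  hilbert_sort :> completeNormedModType K;
  hdot : {dot hilbert_sort for theta};
  hdot_norm : forall x : hilbert_sort, `|x| ^+ 2 = hdot x x
}.

Record alg_ops (K A : Type) := AlgOps {
  azero : A;
  aopp : A -> A;
  aadd : A -> A -> A;
  ascale : K -> A -> A;
  amul : A -> A -> A;
  anorm : A -> K
}.

(* No unit is required: the finite rank operators have none when H is
   infinite-dimensional. *)
Record is_normed_algebra (K : numFieldType) (A : Type) (o : alg_ops K A) : Prop :=
  IsNormedAlgebra {
  aaddA : associative (aadd o);
  aaddC : commutative (aadd o);
  aadd0 : left_id (azero o) (aadd o);
  aaddN : left_inverse (azero o) (aopp o) (aadd o);
  ascaleA : forall a b x, ascale o a (ascale o b x) = ascale o (a * b) x;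
  ascale1 : forall x, ascale o 1 x = x;
  ascaleDr : forall a x y,
    ascale o a (aadd o x y) = aadd o (ascale o a x) (ascale o a y);
  ascaleDl : forall a b x,
    ascale o (a + b) x = aadd o (ascale o a x) (ascale o b x);
  amulA : associative (amul o);
  amulDl : left_distributive (amul o) (aadd o);
  amulDr : right_distributive (amul o) (aadd o);
  ascaleAl : forall a x y, ascale o a (amul o x y) = amul o (ascale o a x) y;
  ascaleAr : forall a x y, ascale o a (amul o x y) = amul o x (ascale o a y);
  anorm_ge0 : forall x, 0 <= anorm o x;
  anorm_eq0 : forall x, anorm o x = 0 -> x = azero o;
  anormZ : forall a x, anorm o (ascale o a x) = `|a| * anorm o x;
  anormD : forall x y, anorm o (aadd o x y) <= anorm o x + anorm o y;
  anormM : forall x y, anorm o (amul o x y) <= anorm o x * anorm o y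
}.

Record normed_algebra_iso (K A B : Type) (o : alg_ops K A) (o' : alg_ops K B)
    (f : A -> B) : Prop := NormedAlgebraIso {
  iso_bij : bijective f;
  iso_add : forall x y, f (aadd o x y) = aadd o' (f x) (f y);
  iso_scale : forall a x, f (ascale o a x) = ascale o' a (f x);
  iso_mul : forall x y, f (amul o x y) = amul o' (f x) (f y);
  iso_norm : forall x, anorm o' (f x) = anorm o x
}.

Section FiniteDimension.
Context {K : numFieldType} {V : lmodType K}.

Definition span_set (s : seq V) : set V :=
  [set x | exists c : nat -> K, x = \sum_(i < size s) c i *: s`_i].

Definition finite_dim (M : set V) := exists s : seq V, M = span_set s.

Record fdsubspace := FdSubspace {
  fd_set :> set V;
  fdP : finite_dim fd_set
}.

Lemma span_nil : span_set [::] = [set 0].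
Proof.
apply/seteqP; split=> x /=; first by case=> c ->; rewrite big_ord0.
by move=> ->; exists (fun=> 0); rewrite big_ord0.
Qed.

Lemma span_cons v s x :
  span_set (v :: s) x <-> exists a y, span_set s y /\ x = a *: v + y.
Proof.
split=> [[c ->]|[a [_ [[c ->] ->]]]].
  exists (c 0%N), (\sum_(i < size s) c i.+1 *: s`_i); split; first by exists (c \o S).
  by rewrite /= big_ord_recl.
exists (fun i => if i is j.+1 then c j else a).
by rewrite /= big_ord_recl.
Qed.

Lemma span_lin s a x y :
  span_set s x -> span_set s y -> span_set s (a *: x + y).
Proof.
move=> [c ->] [d ->]; exists (fun i => a * c i + d i).
rewrite scaler_sumr -big_split /=; apply: eq_bigr => i _.
by rewrite scalerDl scalerA.
Qed.

Lemma span0 s : span_set s 0.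
Proof. by exists (fun=> 0); rewrite big1 // => i _; rewrite scale0r. Qed.

Lemma finite_dim_sub (M U : set V) : finite_dim M -> U `<=` M -> U 0 ->
  (forall a x y, U x -> U y -> U (a *: x + y)) -> finite_dim U.
Proof.
case=> s ->; elim: s U => [|v s IH] U UM U0 Ulin.
  exists [::]; rewrite span_nil in UM *; apply/seteqP; split=> // x -> //.
have [t tE] : finite_dim (U `&` span_set s).
  apply: IH => [x []//||a x y [Ux sx] [Uy sy]]; first by split=> //; exact: span0.
  by split; [exact: Ulin|exact: span_lin].
have [Us|/existsNP[u /not_implyP[Uu nsu]]] := pselect (U `<=` span_set s).
  by exists t; rewrite -tE; apply/seteqP; split=> [x Ux|x []//]; split=> //; exact: Us.
have /span_cons[a [w [sw uE]]] := UM _ Uu.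
have a0 : a != 0.
  by apply/eqP => a0; apply: nsu; rewrite uE a0 scale0r add0r.
exists (u :: t); apply/seteqP; split=> x; last first.
  move=> /span_cons[b [y [ty ->]]]; apply: Ulin => //.
  by move: ty; rewrite -tE => -[].
move=> Ux; have /span_cons[b [y [sy xE]]] := UM _ Ux.
apply/span_cons; exists (b / a), (- (b / a) *: u + x); split; last first.
  by rewrite addrA -scalerDl subrr scale0r add0r.
rewrite -tE; split; first exact: Ulin.
rewrite uE xE scalerDr scalerA mulNr divfK// addrACA scaleNr addNr add0r.
exact: span_lin.
Qed.

End FiniteDimension.
Arguments fdsubspace {K} V.

Section FiniteRankOperators.
Context {K : numFieldType} {theta : K -> K}.
Implicit Type H : hilbertType theta.

Record finop H := FinOp {
  finop_fun :> H -> H;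
  finop_linear : linear finop_fun;
  finop_bounded : exists k : K, forall x, `|finop_fun x| <= k * `|x|;
  finop_finite_rank : finite_dim (range finop_fun)
}.

HB.instance Definition _ H := gen_eqMixin (finop H).
HB.instance Definition _ H := gen_choiceMixin (finop H).

Context {H : hilbertType theta}.
Implicit Types T A B : finop H.

HB.instance Definition _ T :=
  GRing.isLinear.Build K H H *:%R (finop_fun T) (finop_linear T).

Lemma finopP A B : A =1 B -> A = B.
Proof.
case: A B => [f lf bf rf] [g lg bg rg] /= /funext fg; subst g.
by congr FinOp; exact: Prop_irrelevance.
Qed.

Lemma finop_bound T : exists2 k : K, 0 <= k & forall x, `|T x| <= k * `|x|.
Proof.
have [k kT] := finop_bounded T; exists `|k| => // x.
by rewrite -(normr_id x) -normrM -normr_id ger0_le_norm// ?nnegrE// (le_trans _ (kT x)).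
Qed.

Lemma finite_rank_lin (f : H -> H) (M : set H) : linear f -> finite_dim M ->
  range f `<=` M -> finite_dim (range f).
Proof.
move=> lf fM fsub; apply: (finite_dim_sub fM fsub).
  exists 0 => //; have := lf (-1) 0 0.
  by rewrite scaler0 addr0 scaleN1r addNr.
by move=> a _ _ [x _ <-] [y _ <-]; exists (a *: x + y); rewrite ?lf.
Qed.

Lemma finite_rank_comb a A B : exists2 M : set H, finite_dim M &
  range (fun x => a *: A x + B x) `<=` M.
Proof.
have [s sA] := finop_finite_rank A; have [t tB] := finop_finite_rank B.
exists (span_set (s ++ t)); first by exists (s ++ t).
have As x : span_set s (A x) by rewrite -sA; exists x.
have Bt x : span_set t (B x) by rewrite -tB; exists x.
move=> _ [x _ <-]; have := As x; clear As sA; elim: s (A x) => [|v s IH] y /=.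
  by rewrite span_nil => ->; rewrite scaler0 add0r; exact: Bt.
move=> /span_cons[b [z [sz ->]]]; apply/span_cons.
exists (a * b), (a *: z + B x); split; first exact: IH.
by rewrite scalerDr scalerA addrA.
Qed.

Lemma comb_linear a A B : linear (fun x => a *: A x + B x).
Proof.
move=> c x y /=; rewrite (finop_linear A) (finop_linear B) !scalerDr !scalerA.
by rewrite (mulrC a c) addrACA.
Qed.

Lemma comb_bounded a A B :
  exists k : K, forall x, `|a *: A x + B x| <= k * `|x|.
Proof.
have [k _ kA] := finop_bound A; have [l _ lB] := finop_bound B.
exists (`|a| * k + l) => x; rewrite (le_trans (ler_normD _ _))// mulrDl lerD//.
by rewrite normrZ -mulrA ler_wpM2l.
Qed.

Lemma comb_finite_rank a A B : finite_dim (range (fun x => a *: A x + B x)).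
Proof.
have [M fM sM] := finite_rank_comb a A B.
exact: finite_rank_lin (comb_linear a A B) fM sM.
Qed.

Definition opcomb a A B : finop H :=
  FinOp (comb_linear a A B) (comb_bounded a A B) (comb_finite_rank a A B).

Lemma op0_linear : linear (fun _ : H => 0 : H).
Proof. by move=> a x y; rewrite scaler0 addr0. Qed.

Lemma op0_bounded : exists k : K, forall x : H, `|0 : H| <= k * `|x|.
Proof. by exists 0 => x; rewrite normr0 mul0r. Qed.

Lemma op0_finite_rank : finite_dim (range (fun _ : H => 0 : H)).
Proof.
by exists [::]; rewrite span_nil; apply/seteqP; split=> [_ [x _ <-]|_ ->]//; exists 0.
Qed.

Definition op0 : finop H := FinOp op0_linear op0_bounded op0_finite_rank.
Definition opadd A B := opcomb 1 A B.
Definition opscale a A := opcomb a A op0.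
Definition opopp A := opcomb (-1) A op0.

Lemma opaddA : associative opadd.
Proof. by move=> A B C; apply: finopP => x /=; rewrite !scale1r addrA. Qed.

Lemma opaddC : commutative opadd.
Proof. by move=> A B; apply: finopP => x /=; rewrite !scale1r addrC. Qed.

Lemma opadd0 : left_id op0 opadd.
Proof. by move=> A; apply: finopP => x /=; rewrite scaler0 add0r. Qed.

Lemma opaddN : left_inverse op0 opopp opadd.
Proof.
by move=> A; apply: finopP => x /=; rewrite scale1r addr0 scaleN1r addNr.
Qed.

HB.instance Definition _ :=
  GRing.isZmodule.Build (finop H) opaddA opaddC opadd0 opaddN.

Lemma finopD A B x : (A + B) x = A x + B x.
Proof. by rewrite -[A x]scale1r. Qed.

Lemma opscaleE a A x : opscale a A x = a *: A x.
Proof. exact: addr0. Qed.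

Lemma opscaleA a b A : opscale a (opscale b A) = opscale (a * b) A.
Proof. by apply: finopP => x /=; rewrite !addr0 scalerA. Qed.

Lemma opscale1 : left_id 1 opscale.
Proof. by move=> A; apply: finopP => x /=; rewrite addr0 scale1r. Qed.

Lemma opscaleDr : right_distributive opscale +%R.
Proof.
by move=> a A B; apply: finopP => x; rewrite finopD !opscaleE finopD scalerDr.
Qed.

Lemma opscaleDl A : {morph opscale^~ A : a b / a + b}.
Proof.
by move=> a b; apply: finopP => x; rewrite finopD !opscaleE scalerDl.
Qed.

HB.instance Definition _ := GRing.Zmodule_isLmodule.Build K (finop H)
  opscaleA opscale1 opscaleDr opscaleDl.

Lemma finopZ a A x : (a *: A) x = a *: A x.
Proof. exact: addr0. Qed.

Lemma opmul_linear A B : linear (B \o A).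
Proof. by move=> a x y; rewrite /= (finop_linear A) (finop_linear B). Qed.

Lemma opmul_bounded A B : exists k : K, forall x, `|(B \o A) x| <= k * `|x|.
Proof.
have [k k0 kA] := finop_bound A; have [l l0 lB] := finop_bound B.
by exists (l * k) => x /=; rewrite (le_trans (lB _))// -mulrA ler_wpM2l.
Qed.

Lemma opmul_finite_rank A B : finite_dim (range (B \o A)).
Proof.
apply: (finite_rank_lin (opmul_linear A B) (finop_finite_rank B)).
by move=> _ [x _ <-]; exists (A x).
Qed.

(* Composition from left to right: (A *o B) x = B (A x). *)
Definition opmul A B : finop H :=
  FinOp (opmul_linear A B) (opmul_bounded A B) (opmul_finite_rank A B).

Definition opnorm T : K := supremum 0 [set `|T x| | x in [set x | `|x| <= 1]].

Definition finop_ops : alg_ops K (finop H) :=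
  AlgOps 0 -%R +%R *:%R opmul opnorm.

Definition orange T : fdsubspace H := FdSubspace (finop_finite_rank T).

Definition is_orthproj (M : set H) (f : H -> H) :=
  forall x, M (f x) /\ forall y, M y -> hdot H (x - f x) y = 0.

Lemma hdot0C (x y : H) : hdot H x y = 0 -> hdot H y x = 0.
Proof.
have herm u v : hdot H u v = theta (hdot H v u).
  by rewrite [LHS](hermitian_subproof (s := hdot H)) expr0 mul1r.
have t0 : theta 0 = 0 by have := herm 0 0; rewrite !linear0l.
by move=> xy; rewrite herm xy t0.
Qed.

Lemma hdot_gt0 (x : H) : x != 0 -> 0 < hdot H x x.
Proof. exact: neq0_dnorm_gt0. Qed.

Lemma orthproj_exists (M : fdsubspace H) :
  exists2 f : H -> H, linear f & is_orthproj M f.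
Proof.
case: M => _ [s /= ->]; elim: s => [|v s [f lf fP]].
  exists (fun=> 0); first exact: op0_linear.
  move=> x; split=> [|y]; first exact: span0.
  by rewrite span_nil => ->; rewrite linear0r.
pose w := v - f v.
have wM y : span_set s y -> hdot H w y = 0 by move=> /(fP v).2.
have [w0|w0] := eqVneq w 0.
  exists f => // x; split.
    by apply/span_cons; exists 0, (f x); rewrite scale0r add0r; split=> //; exact: (fP x).1.
  move=> _ /span_cons[a [y [sy ->]]]; apply: (fP x).2.
  apply: span_lin => //; move/eqP: w0; rewrite subr_eq0 => /eqP ->.
  exact: (fP v).1.
have ww : hdot H w w != 0 by rewrite gt_eqF ?hdot_gt0.
exists (fun x => (hdot H x w / hdot H w w) *: w + f x).
  move=> a x y /=; rewrite lf linearDl linearZl_LR /= mulrDl -mulrA scalerDl.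
  by rewrite [in RHS]scalerDr scalerA addrACA.
move=> x; split.
  apply/span_cons; exists (hdot H x w / hdot H w w).
  exists (- (hdot H x w / hdot H w w) *: f v + f x); split.
    by apply: span_lin; [exact: (fP v).1|exact: (fP x).1].
  by rewrite /w scalerBr scaleNr addrA.
set b := _ / _.
have zw : hdot H (x - (b *: w + f x)) w = 0.
  rewrite opprD addrCA addrC linearDl linearDl linearNl linearNl linearZl_LR /=.
  rewrite (hdot0C (wM _ (fP x).1)) subr0 divfK// ?subrr//.
have zs y : span_set s y -> hdot H (x - (b *: w + f x)) y = 0.
  move=> sy; rewrite opprD addrCA linearDl linearNl linearZl_LR /= (wM _ sy).
  by rewrite mulr0 oppr0 add0r; exact: (fP x).2.
move=> _ /span_cons[a [y [sy ->]]].
have -> : a *: v + y = a *: w + (a *: f v + y).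
  by rewrite addrA -scalerDr subrK.
rewrite linearDr [X in X + _]linearZr_LR /= zw mulr0 add0r.
by apply: zs; apply: span_lin => //; exact: (fP v).1.
Qed.

Lemma orthproj_id (M : fdsubspace H) f x : is_orthproj M f ->
  fd_set M x -> f x = x.
Proof.
case: M => _ [s /= ->] fP Mx; apply/eqP; rewrite eq_sym -subr_eq0.
apply/negPn/negP => /hdot_gt0; rewrite (fP x).2 ?ltxx//.
have := span_lin (-1) (fP x).1 Mx.
by rewrite scaleN1r addrC.
Qed.

Lemma orthproj_bounded (M : fdsubspace H) f : is_orthproj M f ->
  exists k : K, forall x, `|f x| <= k * `|x|.
Proof.
move=> fP; exists 1 => x; rewrite mul1r.
rewrite -(@ler_pXn2r _ 2) ?nnegrE// !hdot_norm.
have : hdot H (x - f x) (f x) = 0 by apply: (fP x).2; exact: (fP x).1.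
have : x = (x - f x) + f x by rewrite subrK.
move: (x - f x) => z xE o1; have o2 := hdot0C o1.
rewrite [in leRHS]xE linearDl !linearDr /= o1 o2 addr0 add0r.
by rewrite lerDr -hdot_norm exprn_ge0.
Qed.

Lemma orthproj_range (M : fdsubspace H) f : is_orthproj M f ->
  range f = M :> set H.
Proof.
move=> fP; apply/seteqP; split=> [_ [x _ <-]|x Mx]; first exact: (fP x).1.
by exists x => //; exact: orthproj_id fP Mx.
Qed.

Lemma orthproj_finop (M : fdsubspace H) : exists P : finop H, is_orthproj M P.
Proof.
have [f lf fP] := orthproj_exists M.
have rf : finite_dim (range f) by rewrite (orthproj_range fP); exact: fdP.
by exists (FinOp lf (orthproj_bounded fP) rf).
Qed.

Definition orthproj (M : fdsubspace H) : finop H := projT1 (cid (orthproj_finop M)).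

Lemma orthprojP (M : fdsubspace H) : is_orthproj M (orthproj M).
Proof. exact: projT2 (cid (orthproj_finop M)). Qed.

Lemma orthproj_idem (M : fdsubspace H) : opmul (orthproj M) (orthproj M) = orthproj M.
Proof.
apply: finopP => x /=; apply: (orthproj_id (@orthprojP M)).
exact: (@orthprojP M x).1.
Qed.

End FiniteRankOperators.
Arguments finop {K theta} H.
Infix "*o" := opmul (at level 40, left associativity).

Section IdealCategory.
Context {K : numFieldType} {theta : K -> K} {H : hilbertType theta}.
Implicit Types A T : finop H.

Record idem := Idem {
  idem_op :> finop H;
  idemP : idem_op *o idem_op = idem_op
}.

Definition proj (M : fdsubspace H) : idem := Idem (orthproj_idem M).

Definition left_ideal (P : finop H) : set (finop H) := [set A *o P | A in setT].

Record obj := Obj {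
  obj_set :> set (finop H);
  objP : exists P : idem, obj_set = left_ideal P
}.

Definition SP (P : idem) : obj := Obj (ex_intro _ P erefl).

Lemma obj_eq (c d : obj) : c = d :> set (finop H) -> c = d.
Proof.
case: c d => [c pc] [d pd] /= cd; subst d.
by congr Obj; exact: Prop_irrelevance.
Qed.

Lemma SP_mem (P : idem) A : A \in obj_set (SP P) -> A *o P = A.
Proof. by rewrite in_setE => -[B _ <-]; apply: finopP => x /=; rewrite -[in RHS](idemP P). Qed.

Definition in_corner (P T Q : finop H) := exists A, T = (P *o A) *o Q.

Definition is_rho (P : idem) T (Q : idem) (c d : obj) (f : c -> d) :=
  [/\ c = SP P, d = SP Q, in_corner P T Q & forall A : c, \val (f A) = \val A *o T].

Record hom (c d : obj) := Hom {
  hom_fun :> c -> d;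
  homP : exists P T Q, is_rho P T Q hom_fun
}.

Lemma hom_eq (c d : obj) (f g : hom c d) : f =1 g -> f = g.
Proof.
case: f g => [f pf] [g pg] /= /funext fg; subst g.
by congr Hom; exact: Prop_irrelevance.
Qed.

Lemma idem_mulA (P : idem) A : P *o (P *o A) = P *o A.
Proof. by apply: finopP => x /=; rewrite -[in RHS](idemP P). Qed.

Section RightMultiplication.
Context {c d : obj} {T : finop H}.
Hypothesis cTd : forall A, obj_set c A -> obj_set d (A *o T).

Lemma rmul_subproof (A : c) : (\val A *o T) \in obj_set d.
Proof. by apply/mem_set/cTd/set_mem; exact: (valP A). Qed.

Definition rmul_fun (A : c) : d := exist (fun B => B \in obj_set d) _ (rmul_subproof A).

Lemma rmulP : exists P T' Q, is_rho P T' Q rmul_fun.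
Proof.
have [P cP] := objP c; have [Q dQ] := objP d.
exists P, (P *o T), Q; split; [exact: obj_eq|exact: obj_eq| |].
  have PTQ : (P *o T) *o Q = P *o T.
    apply: SP_mem; rewrite in_setE /= -dQ; apply: cTd; rewrite cP.
    by exists P => //; exact: idemP.
  by exists (P *o T); rewrite idem_mulA PTQ.
move=> A /=; have AP : \val A *o P = \val A.
  by apply: SP_mem; rewrite /= -cP; exact: (valP A).
by apply: finopP => x /=; rewrite -[in LHS]AP.
Qed.

(* A |-> A T, where T need not be reduced: as a map SP -> SQ this is
   rho(P, P T, Q). *)
Definition rmul : hom c d := Hom rmulP.

End RightMultiplication.

Lemma corner_absorb (P : idem) T (Q : idem) : in_corner P T Q -> P *o T = T.
Proof.
move=> [B ->]; apply: finopP => x.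
by have /= -> := congr1 (fun D : finop H => D x) (idemP P).
Qed.

Lemma corner_mul (P : idem) T (Q : idem) : in_corner P T Q ->
  forall A, obj_set (SP P) A -> obj_set (SP Q) (A *o T).
Proof. by move=> [B ->] A _; exists (A *o (P *o B)) => //; exact: finopP. Qed.

Definition rho (P : idem) T (Q : idem) (h : in_corner P T Q) : hom (SP P) (SP Q) :=
  rmul (corner_mul h).

Section Inclusion.
Context {c d : obj}.
Hypothesis cd : obj_set c `<=` obj_set d.

Lemma incl_subproof (A : c) : \val A \in obj_set d.
Proof. by apply/mem_set/cd/set_mem; exact: (valP A). Qed.

Definition incl_fun (A : c) : d := exist (fun B => B \in obj_set d) _ (incl_subproof A).

Lemma inclP : exists P T Q, is_rho P T Q incl_fun.
Proof.
have [P cP] := objP c; have [Q dQ] := objP d.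
exists P, P, Q; split; [exact: obj_eq|exact: obj_eq| |].
  exists P; rewrite idemP SP_mem// in_setE /= -dQ; apply: cd; rewrite cP.
  by exists P => //; exact: idemP.
by move=> A /=; rewrite SP_mem//= -cP; exact: (valP A).
Qed.

Definition incl : hom c d := Hom inclP.

End Inclusion.

Definition hid (c : obj) : hom c c := incl (fun _ cA => cA).

Lemma hcompP (c d e : obj) (f : hom c d) (g : hom d e) :
  exists P T Q, is_rho P T Q (g \o f).
Proof.
have [P [T [Q [cP dQ [A ->] fE]]]] := homP f.
have [Q' [T' [R [dQ' eR [B ->] gE]]]] := homP g.
exists P, (P *o (A *o Q *o Q' *o B) *o R), R; split=> //.
  by exists (A *o Q *o Q' *o B).
by move=> C /=; rewrite gE fE; exact: finopP.
Qed.

(* First f, then g. *)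
Definition hcomp (c d e : obj) (f : hom c d) (g : hom d e) : hom c e :=
  Hom (hcompP f g).

Lemma obj_SP (c : obj) : exists M : fdsubspace H, c = SP (proj M).
Proof.
have [P cP] := objP c; exists (orange P); apply: obj_eq; rewrite cP.
have PM : P *o proj (orange P) = P.
  by apply: finopP => x /=; apply: (orthproj_id (@orthprojP _ _ _ (orange P))); exists x.
have MP : proj (orange P) *o P = proj (orange P).
  apply: finopP => x /=; have [[y _ /= <-] _] := @orthprojP _ _ _ (orange P) x.
  by rewrite -[in RHS](idemP P).
apply/seteqP; split=> _ [A _ <-].
  by exists (A *o P) => //; rewrite -[in RHS]PM; exact: finopP.
by exists (A *o proj (orange P)) => //; rewrite -[in RHS]MP; exact: finopP.
Qed.

Lemma SP_proj_inj (M N : fdsubspace H) : SP (proj M) = SP (proj N) -> M = N.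
Proof.
move=> /(congr1 obj_set) /= MN.
have sub (L L' : fdsubspace H) : left_ideal (proj L) = left_ideal (proj L') ->
    fd_set L `<=` fd_set L'.
  move=> LL' x Lx; have : left_ideal (proj L) (proj L).
    by exists (proj L) => //; exact: idemP.
  rewrite LL' => -[B _ /(congr1 (fun D : finop H => D x)) /=].
  rewrite (orthproj_id (@orthprojP _ _ _ L) Lx) => <-.
  exact: (@orthprojP _ _ _ L' _).1.
have : fd_set M = fd_set N by apply/seteqP; split; exact: sub.
case: M N {MN sub} => [M fM] [N fN] /= MN; subst N.
by congr FdSubspace; exact: Prop_irrelevance.
Qed.

(* The norm of rho(P_M, T, P_N) is that of T, see hom_norm_rho. *)
Definition hom_norm (c d : obj) (f : hom c d) : K :=
  xget 0 [set opnorm T | T in [set T | exists M N : fdsubspace H,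
                                 is_rho (proj M) T (proj N) f]].

Lemma hom_norm_rho (M N : fdsubspace H) T (h : in_corner (proj M) T (proj N)) :
  hom_norm (rho h) = opnorm T.
Proof.
have rhoT : is_rho (proj M) T (proj N) (rho h) by split.
apply: xget_unique; first by exists T => //; exists M, N.
move=> _ [T' [M' [N' [/SP_proj_inj MM' _ [B T'E] fT']] <-]]; subst M'.
congr opnorm; case: rhoT => _ _ _ fT.
have projM : proj M *o T = proj M *o T'.
  have PP : (proj M : finop H) \in obj_set (SP (proj M)).
    by rewrite in_setE; exists (proj M) => //; exact: idemP.
  pose E : SP (proj M) := exist (fun B => B \in obj_set _) _ PP.
  by rewrite -(fT E) -(fT' E).
by rewrite -(corner_absorb h) projM (corner_absorb (ex_intro _ B T'E)).
Qed.

Definition is_iso (c d : obj) (f : hom c d) :=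
  exists g : hom d c, hcomp f g = hid c /\ hcomp g f = hid d.

Definition is_retraction (c d : obj) (q : hom c d) :=
  exists dc : obj_set d `<=` obj_set c, hcomp (incl dc) q = hid d.

(* f = q u j is a normal factorization of f and e = q u its epimorphic
   component. *)
Definition is_epi_component (c d d' : obj) (f : hom c d) (e : hom c d') :=
  exists (c' : obj) (q : hom c c') (u : hom c' d')
         (sub : obj_set d' `<=` obj_set d),
    [/\ is_retraction q, is_iso u, f = hcomp (hcomp q u) (incl sub)
      & e = hcomp q u].

Record cone_family := ConeFamily {
  vertex : obj;
  component : forall c : obj, hom c vertex
}.
Implicit Types g s : cone_family.

Definition is_cone g := forall (c' c : obj) (sub : obj_set c' `<=` obj_set c),
  hcomp (incl sub) (component g c) = component g c'.

Definition is_normal g := exists c : obj, is_iso (component g c).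

Definition is_bounded g := exists2 alpha : K, alpha \is Num.real &
  forall c : obj, hom_norm (component g c) <= alpha.

Record bncone := BNCone {
  bncone_family :> cone_family;
  bncone_cone : is_cone bncone_family;
  bncone_normal : is_normal bncone_family;
  bncone_bounded : is_bounded bncone_family
}.

Definition is_cone_product g s (p : cone_family) :=
  exists (d : obj) (e : hom (vertex g) d),
    is_epi_component (component s (vertex g)) e /\
    p = ConeFamily (fun c => hcomp (component g c) e).

Lemma principal_sub T A : obj_set (SP (proj (orange T))) (A *o T).
Proof.
exists (A *o T) => //; apply: finopP => x /=.
by apply: (orthproj_id (@orthprojP _ _ _ (orange T))); exists (A x).
Qed.

Definition principal_cone T : cone_family :=
  @ConeFamily (SP (proj (orange T)))
    (fun c => rmul (fun A (_ : obj_set c A) => principal_sub T A)).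

Lemma principal_coneE T (M : fdsubspace H) :
  exists h : in_corner (proj M) (proj M *o T) (proj (orange T)),
    component (principal_cone T) (SP (proj M)) = rho h.
Proof.
have h : in_corner (proj M) (proj M *o T) (proj (orange T)).
  exists (proj M *o T); rewrite idem_mulA; apply: finopP => x /=.
  by apply/esym/(orthproj_id (@orthprojP _ _ _ (orange T))); exists (proj M x).
exists h; apply: hom_eq => A; apply: val_inj => /=.
by rewrite -[in LHS](SP_mem (valP A)); exact: finopP.
Qed.

End IdealCategory.
Arguments obj {K theta} H.
Arguments cone_family {K theta} H.
Arguments bncone {K theta} H.
Arguments finop_ops {K theta} H.

(* Main.v *)
(** The components of a bounded normal cone at the ideals [SP_M] are right
    multiplications by operators [T_M], and the cone condition says that [T_M]
    and [T_M'] agree on [M'] whenever [M'] is contained in [M].  They glue to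
    the linear map [T x := T_<x> x], which is bounded because the cone is and
    whose range is the space of the vertex because one component is an
    isomorphism; so the cone is [rho^T].  Conversely a finite rank [T] has a
    finite rank right inverse [S] on its range [N]: with [X := P_N S] and [M]
    the range of [X], right multiplication by [T] maps [SP_M] isomorphically
    onto [SP_N].  The same device, applied to [A B], splits [B] on the range
    of [A] into a retraction and an isomorphism, whence
    [rho^A . rho^B = rho^(AB)]. *)
Require Import Defs.
From mathcomp Require Import all_boot all_order all_algebra.
From mathcomp Require Import complex.
From mathcomp Require Import boolp classical_sets reals topology normedtype.
Set Implicit Arguments.
Unset Strict Implicit.
Unset Printing Implicit Defensive.
Import Order.TTheory GRing.Theory Num.Theory.
Local Open Scope ring_scope.

(** * Transport of a normed algebra structure along a bijection *)

Section Transport.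
Context {K : numFieldType} {A B : Type}.

Definition transport_ops (o : alg_ops K A) (f : A -> B) (h : B -> A) : alg_ops K B :=
  AlgOps (f (azero o)) (fun x => f (aopp o (h x)))
    (fun x y => f (aadd o (h x) (h y))) (fun a x => f (ascale o a (h x)))
    (fun x y => f (amul o (h x) (h y))) (fun x => anorm o (h x)).

Lemma transport_normed_algebra (o : alg_ops K A) (f : A -> B) (h : B -> A) :
  cancel f h -> cancel h f -> is_normed_algebra o ->
  is_normed_algebra (transport_ops o f h).
Proof.
move=> fK hK [? ? add0 ? ? scale1 ? ? ? ? ? ? ? ? norm0 ? ? ?].
split=> //= *; try move=> ? *; rewrite ?fK //; try by congr f.
(* The unit laws end in the element itself, so they need [cancel h f] as well as [cancel f h]. *)
- by rewrite add0 hK.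
- by rewrite scale1 hK.
- by apply: (can_inj hK); rewrite fK; exact: norm0.
Qed.

End Transport.

(** * Spans of finite lists *)

Section Span.
Local Open Scope classical_set_scope.
Context {K : numFieldType} {V : lmodType K}.

Definition spanned (s : seq V) : fdsubspace V := FdSubspace (ex_intro _ s erefl).

Lemma mem_span_head v (s : seq V) : span_set (v :: s) v.
Proof.
apply/Defs.span_cons; exists 1, 0.
by split; [exact: Defs.span0|rewrite scale1r addr0].
Qed.

Lemma mem_span_tail v (s : seq V) x : span_set s x -> span_set (v :: s) x.
Proof. by move=> sx; apply/Defs.span_cons; exists 0, x; rewrite scale0r add0r. Qed.

Lemma span1P (v x : V) : span_set [:: v] x <-> exists a, x = a *: v.
Proof.
split=> [/Defs.span_cons[a [y [+ ->]]]|[a ->]].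
  by rewrite Defs.span_nil => ->; exists a; rewrite addr0.
by apply/Defs.span_cons; exists a, 0; split; [exact: Defs.span0|rewrite addr0].
Qed.

Lemma fdsubspace_eq (M N : fdsubspace V) : fd_set M = fd_set N -> M = N.
Proof.
case: M N => [M fM] [N fN] /= MN; subst N.
by congr FdSubspace; exact: Prop_irrelevance.
Qed.

End Span.

(** * Orthogonal projections and right inverses of finite rank operators *)

Section FiniteRank.
Local Open Scope classical_set_scope.
Context {K : numFieldType} {theta : K -> K} {H : hilbertType theta}.
Implicit Types (T A B S X : finop H) (M N : fdsubspace H).

Lemma opmulE A B x : (A *o B) x = B (A x).
Proof. by []. Qed.

Lemma orthproj_in M x : fd_set M (orthproj M x).
Proof. exact: (@orthprojP _ _ _ M x).1. Qed.

Lemma orthproj_fix M x : fd_set M x -> orthproj M x = x.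
Proof. exact: orthproj_id (@orthprojP _ _ _ M). Qed.

(** Pythagoras for the orthogonal vectors [x - orthproj M x] and [orthproj M x]. *)
Lemma orthproj_contract M x : `|orthproj M x| <= `|x|.
Proof.
rewrite -(@ler_pXn2r _ 2) ?nnegrE// !hdot_norm.
have o1 : hdot H (x - orthproj M x) (orthproj M x) = 0.
  by apply: (@orthprojP _ _ _ M x).2; exact: orthproj_in.
have := subrK (orthproj M x) x; move: (x - orthproj M x) o1 => z o1 {3 4}<-.
rewrite linearDl !linearDr /= o1 (hdot0C o1) addr0 add0r.
by rewrite lerDr -hdot_norm exprn_ge0.
Qed.

(** The set contains the norm of [T 0], so [supremum] does not fall back on its default value for
    the empty set, and least upper bounds are unique. *)
Lemma opnorm_set_lub T a : supremums [set `|T x| | x in [set x : H | `|x| <= 1]] a ->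
  opnorm T = a.
Proof.
move=> supa; rewrite /opnorm /supremum ifF; last first.
  apply/eqP => e; have : [set `|T x| | x in [set x : H | `|x| <= 1]] `|T 0|.
    by exists 0 => //=; rewrite normr0.
  by rewrite e.
by apply: xget_subset1 => //; exact: is_subset1_supremums.
Qed.

Lemma rank_one_exists (u w : H) : w != 0 ->
  exists E : finop H, forall x, E x = (hdot H x w / hdot H w w) *: u.
Proof.
move=> w0; pose f x := (hdot H x w / hdot H w w) *: u.
have ww : hdot H w w != 0 by rewrite gt_eqF ?hdot_gt0.
have lf : linear f.
  move=> a x y; rewrite /f linearDl linearZl_LR /= mulrDl scalerDl.
  by rewrite scalerA mulrA.
have bf : exists k : K, forall x, `|f x| <= k * `|x|.
  (* This constant is the Cauchy-Schwarz bound, obtained here from the projection onto the line of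
     [w] being a contraction. *)
  exists (`|u| / `|w|) => x.
  have [/span1P[c cE] ort] := @orthprojP _ _ _ (spanned [:: w]) x.
  have := orthproj_contract (spanned [:: w]) x.
  have := ort _ (mem_span_head _ _); rewrite cE linearDl linearNl linearZl_LR /=.
  move=> /eqP; rewrite subr_eq0 => /eqP xw.
  rewrite /f xw mulfK// !normrZ => cw.
  by rewrite mulrAC ler_pdivlMr ?normr_gt0// mulrAC mulrC ler_wpM2l.
have rf : finite_dim (range f).
  apply: (finite_rank_lin lf (M := span_set [:: u])); first by exists [:: u].
  by move=> _ [x _ <-]; apply/span1P; exists (hdot H x w / hdot H w w).
by exists (FinOp lf bf rf).
Qed.

(** Induction on a list spanning the range: a right inverse on the span of the tail is corrected by
    a rank one operator that vanishes there. *)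
Lemma right_inverse_exists T :
  exists S, forall y, range T y -> T (S y) = y.
Proof.
have [s0 s0E] := finop_finite_rank T.
suff [S SP] : exists S, forall y, span_set s0 y -> T (S y) = y.
  by exists S => y; rewrite s0E; exact: SP.
have : span_set s0 `<=` range T by rewrite s0E.
elim: s0 {s0E} => [_|v s IH vsT].
  exists 0 => y; rewrite Defs.span_nil => ->.
  exact: linear0.
have [S SP] := IH (fun y sy => vsT y (mem_span_tail v sy)).
have [u _ uv] : range T v by apply: vsT; exact: mem_span_head.
pose L := spanned s.
pose w := v - orthproj L v.
have wL y : span_set s y -> hdot H w y = 0 by exact: (@orthprojP _ _ _ L v).2.
have [w0|w0] := eqVneq w 0.
  exists S => _ /Defs.span_cons[a [y [sy ->]]]; apply: SP; apply: span_lin => //.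
  by move/eqP: w0; rewrite subr_eq0 => /eqP ->; exact: (orthproj_in L).
have ww : hdot H w w != 0 by rewrite gt_eqF ?hdot_gt0.
(* [E] sends [v] to [u - S v] and vanishes on the span of [s]. *)
have [E EP] := rank_one_exists (u - S v) w0.
exists (E + S) => _ /Defs.span_cons[a [y [sy ->]]].
have vw : hdot H v w = hdot H w w.
  rewrite -{1}(subrK (orthproj L v) v) -/w linearDl /=.
  by rewrite (hdot0C (wL _ (orthproj_in L v))) addr0.
rewrite finopD EP linearDl linearZl_LR /= vw (hdot0C (wL _ sy)) addr0 mulfK//.
by rewrite (linearP S) scalerBr addrA subrK (linearP T) /= uv SP.
Qed.

(** * Morphisms between the ideals of finite-dimensional subspaces *)

Lemma SP_projE M A : obj_set (SP (proj M)) A <-> forall x, fd_set M (A x).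
Proof.
split=> [[B _ <-] x|AM]; first exact: orthproj_in.
by exists A => //; apply: finopP => x; exact: orthproj_fix.
Qed.

Lemma SP_val M (A : obj_set (SP (proj M))) x : fd_set M (\val A x).
Proof. by have /SP_projE := set_mem (valP A); exact. Qed.

Lemma proj_mem M : obj_set (SP (proj M)) (proj M).
Proof. by apply/SP_projE => x; exact: orthproj_in. Qed.

Definition ideal_elt (c : obj H) A (cA : obj_set c A) : c :=
  exist (fun B => B \in obj_set c) A (mem_set cA).

(** The idempotents witnessing a morphism need not be orthogonal projections; the image of the
    generator [proj M] provides the reduced operator. *)
Lemma hom_rho M N (f : Defs.hom (SP (proj M)) (SP (proj N))) :
  exists T (h : in_corner (proj M) T (proj N)), f = rho h.
Proof.
have [P [T [Q [_ _ _ fE]]]] := homP f.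
have TN : obj_set (SP (proj N)) (proj M *o T).
  by rewrite -(fE (ideal_elt (proj_mem M))); apply: set_mem; exact: (valP (f _)).
have h : in_corner (proj M) (proj M *o T) (proj N).
  by exists (proj M *o T); rewrite idem_mulA SP_mem// mem_set.
exists (proj M *o T), h; apply: hom_eq => A; apply: val_inj; rewrite fE /=.
by apply: finopP => x /=; rewrite (orthproj_fix (SP_val A x)).
Qed.

(** The inverse is right multiplication by [X]: the two equations give [X *o B *o X = X], so
    [B *o X] fixes the range of [X] pointwise. *)
Lemma rmul_iso N B X
    (BN : forall C, obj_set (SP (proj (orange X))) C -> obj_set (SP (proj N)) (C *o B)) :
  proj N *o X = X -> X *o B = proj N -> is_iso (rmul BN).
Proof.
move=> NX XB.
have BE y : B (X y) = orthproj N y by have /= := congr1 (fun D : finop H => D y) XB.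
have XE y : X (orthproj N y) = X y by have /= := congr1 (fun D : finop H => D y) NX.
have XM C : obj_set (SP (proj N)) C -> obj_set (SP (proj (orange X))) (C *o X).
  by move=> _; apply/SP_projE => x; exists (C x).
exists (rmul XM); split; apply: hom_eq => C; apply: val_inj; apply: finopP => x /=.
  by have [y _ <-] := SP_val C x; rewrite BE XE.
by rewrite BE orthproj_fix//; exact: SP_val.
Qed.

(** * Principal cones and their products *)

Lemma cone_eq_principal T (v : obj H) (comp : forall c, Defs.hom c v) :
  v = SP (proj (orange T)) -> (forall (c : obj H) (A : c), \val (comp c A) = \val A *o T) ->
  ConeFamily comp = principal_cone T.
Proof.
(* Once the vertex is substituted, both families of components have the same type. *)
move=> vE; subst v => compE; congr ConeFamily.
apply: functional_extensionality_dep => c.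
by apply: hom_eq => A; apply: val_inj; rewrite compE.
Qed.

Lemma principal_cone_inj : injective (@principal_cone _ _ H).
Proof.
move=> T T' TT'; apply: finopP => x.
(* The component at the span of [x], applied to the generator and evaluated at [x], returns
   [T x]. *)
pose L := spanned [:: x].
have := congr1 (fun g => \val (component g (SP (proj L)) (ideal_elt (proj_mem L))) x) TT'.
by rewrite /= orthproj_fix//; exact: mem_span_head.
Qed.

Lemma principal_cone_is_cone T : is_cone (principal_cone T).
Proof. by move=> c' c sub; apply: hom_eq => A; exact: val_inj. Qed.

Lemma principal_cone_is_normal T : is_normal (principal_cone T).
Proof.
have [S TS] := right_inverse_exists T.
pose X := proj (orange T) *o S.
exists (SP (proj (orange X))); apply: rmul_iso; first exact: idem_mulA.
by apply: finopP => x /=; rewrite TS//; exact: (orthproj_in (orange T)).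
Qed.

(** A retraction followed by an isomorphism is onto, and the final inclusion does not change values.
    Hence the codomain of [e] is the image of [f], whichever factorization is taken. *)
Lemma epi_componentE (c d d' : obj H) (f : Defs.hom c d) (e : Defs.hom c d') :
  is_epi_component f e ->
  (forall C : c, \val (e C) = \val (f C)) /\ forall D, exists C, e C = D.
Proof.
move=> [c' [q [u [sub [[inc qr] [u' [_ u'u]] -> ->]]]]]; split=> // D.
exists (incl inc (u' D)).
have qE C : q (incl inc C) = C.
  by have /= -> := congr1 (fun h : Defs.hom _ _ => h C) qr; exact: val_inj.
rewrite /= [q _]qE.
by have /= -> := congr1 (fun h : Defs.hom _ _ => h D) u'u; exact: val_inj.
Qed.

Lemma principal_cone_product A B (p : cone_family H) :
  is_cone_product (principal_cone A) (principal_cone B) p <->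
  p = principal_cone (A *o B).
Proof.
have [S ABS] := right_inverse_exists (A *o B).
split=> [[d [e [/epi_componentE[eE esurj] ->]]]|->].
  apply: cone_eq_principal => [|c C]; last by rewrite [LHS]eE; exact: finopP.
  apply: obj_eq; apply/seteqP; split=> D.
    move=> dD; apply/SP_projE => x; have [C CD] := esurj (ideal_elt dD).
    have := eE C; rewrite CD /= => ->.
    by have [y _ yC] := SP_val C x; exists y => //=; rewrite yC.
  move=> /SP_projE DAB.
  (* [D *o S *o A] is a preimage of [D] under [e], since [S] is a right inverse of [A *o B] on its
     range. *)
  have CA : obj_set (SP (proj (orange A))) (D *o S *o A).
    by apply/SP_projE => x; exists (S (D x)).
  suff <- : \val (e (ideal_elt CA)) = D by apply: set_mem; exact: (valP (e _)).
  by rewrite eE; apply: finopP => x /=; exact: (ABS _ (DAB x)).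
(* [X] is a section of [B] over [N] with values in the range of [A]; its range is a subspace that
   [B] maps isomorphically onto [N]. *)
pose N := orange (A *o B); pose X := proj N *o (S *o A).
have NX : proj N *o X = X by exact: idem_mulA.
have XB : X *o B = proj N.
  by apply: finopP => x; exact: (ABS _ (orthproj_in N x)).
have XA y : range A (X y) by exists (S (orthproj N y)).
clearbody X.
have XBE y : B (X y) = orthproj N y by have /= := congr1 (fun D : finop H => D y) XB.
have XE y : X (orthproj N y) = X y by have /= := congr1 (fun D : finop H => D y) NX.
have BN C : obj_set (SP (proj (orange A))) C -> obj_set (SP (proj N)) (C *o B).
  move=> /SP_projE CA; apply/SP_projE => x.
  by have [y _ yC] := CA x; exists y => //=; rewrite yC.
have MA : obj_set (SP (proj (orange X))) `<=` obj_set (SP (proj (orange A))).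
  move=> C /SP_projE CX; apply/SP_projE => x; have [y _ <-] := CX x.
  exact: XA.
have sub : obj_set (SP (proj N)) `<=` obj_set (SP (proj (orange B))).
  move=> C /SP_projE CN; apply/SP_projE => x; have [y _ <-] := CN x.
  by exists (A y).
have qM C : obj_set (SP (proj (orange A))) C ->
    obj_set (SP (proj (orange X))) (C *o (B *o X)).
  by move=> _; apply/SP_projE => x; exists (B (C x)).
(* On the range of [A], [B *o X] is a projection onto the range of [X], which makes [q] a
   retraction; [u] is then right multiplication by [B]. *)
pose q := rmul qM; pose u := rmul (fun C (CX : obj_set _ C) => BN C (MA C CX)).
exists (SP (proj N)), (hcomp q u); split; last first.
  apply/esym/cone_eq_principal => // c C /=; apply: finopP => x /=.
  by rewrite XBE orthproj_fix//; exists (\val C x).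
exists (SP (proj (orange X))), q, u, sub; split=> //.
- exists MA; apply: hom_eq => C; apply: val_inj; apply: finopP => x /=.
  by have [y _ <-] := SP_val C x; rewrite XBE XE.
- exact: rmul_iso.
- apply: hom_eq => C; apply: val_inj; apply: finopP => x /=.
  rewrite XBE orthproj_fix//.
  by have [y _ <-] := SP_val C x; exists y.
Qed.

End FiniteRank.

(** * The operator norm and the classification of bounded normal cones *)

Section BoundedCones.
Local Open Scope classical_set_scope.
Context {R : realType} {k : ground} {H : hilbertType (@scalar_conj R k)}.
Implicit Types (T A B : finop H) (M N : fdsubspace H).

Lemma scalars_supremum (A : set (scalars R k)) : A !=set0 -> has_ubound A ->
  (forall a, A a -> a \is Num.real) -> supremums A !=set0.
Proof.
case: k A => /= A A0 uA Areal.
  by exists (sup A); split; [exact: sup_upper_bound|move=> x; exact: ge_sup].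
have [a0 Aa0] := A0; have [m mA] := uA.
have ReA x : A x -> x = (complex.Re x)%:C%C by move=> /Areal /RRe_real.
pose E := @complex.Re R @` A.
have supE : has_sup E.
  split; first by exists (complex.Re a0), a0.
  by exists (complex.Re m) => _ [a Aa <-]; have := mA _ Aa; rewrite lecE => /andP[].
exists (sup E)%:C%C; split=> [a Aa|x xA].
  rewrite (ReA _ Aa) lecR; apply: (sup_upper_bound supE).
  by exists a.
(* Comparable elements of [R[i]] have equal imaginary parts, so an upper bound of a nonempty set of
   reals is real. *)
have imx : complex.Im x = 0.
  by have := xA _ Aa0; rewrite lecE {1}(ReA _ Aa0) /= => /andP[/eqP ->].
rewrite lecE /= imx eqxx /=; apply: ge_sup; first by case: supE.
by move=> _ [a Aa <-]; have := xA _ Aa; rewrite lecE => /andP[].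
Qed.

Lemma opnorm_supremum T :
  supremums [set `|T x| | x in [set x : H | `|x| <= 1]] (opnorm T).
Proof.
set A := [set _ | _ in _].
suff [a supa] : supremums A !=set0 by rewrite (opnorm_set_lub supa).
apply: scalars_supremum.
- by exists `|T 0|, 0 => //=; rewrite normr0.
- have [m m0 mT] := finop_bound T; exists m => _ [x x1 <-].
  by rewrite (le_trans (mT x))// ler_piMr.
- by move=> _ [x _ <-]; exact: normr_real.
Qed.

Lemma opnorm_ge0 T : 0 <= opnorm T.
Proof.
by apply: (opnorm_supremum T).1; exists 0 => /=; rewrite ?linear0 normr0.
Qed.

Lemma ler_opnorm T x : `|T x| <= opnorm T * `|x|.
Proof.
have [->|x0] := eqVneq x 0; first by rewrite linear0 !normr0 mulr0.
have nx : 0 < `|x| by rewrite normr_gt0.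
rewrite -ler_pdivrMr// mulrC.
have -> : `|x|^-1 * `|T x| = `|T (`|x|^-1 *: x)|.
  by rewrite linearZ normrZ ger0_norm// invr_ge0.
apply: (opnorm_supremum T).1; exists (`|x|^-1 *: x) => //=.
by rewrite normrZ ger0_norm ?invr_ge0// mulVf// gt_eqF.
Qed.

Lemma opnorm_le T a : 0 <= a -> (forall x, `|T x| <= a * `|x|) -> opnorm T <= a.
Proof.
move=> a0 aT; apply: (opnorm_supremum T).2 => _ [x x1 <-].
by rewrite (le_trans (aT x))// ler_piMr.
Qed.

Lemma finop_normed_algebra : is_normed_algebra (finop_ops H).
Proof.
split=> /=.
- exact: addrA.
- exact: addrC.
- exact: add0r.
- exact: addNr.
- exact: scalerA.
- exact: scale1r.
- exact: scalerDr.
- by move=> *; exact: scalerDl.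
- by move=> A B C; exact: finopP.
- by move=> A B C; apply: finopP => x; rewrite finopD !opmulE finopD linearD.
- by move=> A B C; apply: finopP => x; rewrite finopD !opmulE finopD.
- by move=> a A B; apply: finopP => x; rewrite finopZ !opmulE finopZ linearZ.
- by move=> a A B; apply: finopP => x; rewrite finopZ !opmulE finopZ.
- exact: opnorm_ge0.
- move=> T T0; apply: finopP => x; apply/eqP; rewrite -normr_le0.
  by rewrite (le_trans (ler_opnorm T x))// T0 mul0r.
- move=> a T; apply/le_anti/andP; split.
    apply: opnorm_le; first by rewrite mulr_ge0// opnorm_ge0.
    by move=> x; rewrite finopZ normrZ -mulrA ler_wpM2l// ler_opnorm.
  have [->|a0] := eqVneq a 0; first by rewrite normr0 mul0r opnorm_ge0.
  have na : 0 < `|a| by rewrite normr_gt0.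
  (* For nonzero [a], the quotient of [opnorm (a *: T)] by the modulus of [a] is a bound for [T]. *)
  rewrite mulrC -ler_pdivlMr//; apply: opnorm_le.
    by rewrite divr_ge0// opnorm_ge0.
  move=> x; rewrite mulrAC ler_pdivlMr// mulrC -normrZ -finopZ.
  exact: ler_opnorm.
- move=> A B; apply: opnorm_le; first by rewrite addr_ge0// opnorm_ge0.
  move=> x; rewrite finopD mulrDl (le_trans (ler_normD _ _))// lerD//;
  exact: ler_opnorm.
- move=> A B; apply: opnorm_le; first by rewrite mulr_ge0// opnorm_ge0.
  move=> x /=; rewrite (le_trans (ler_opnorm B _))// mulrC mulrAC.
  by rewrite ler_wpM2r ?opnorm_ge0// ler_opnorm.
Qed.

Lemma principal_cone_is_bounded T : is_bounded (principal_cone T).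
Proof.
exists (opnorm T); first by rewrite ger0_real// opnorm_ge0.
move=> c; have [M ->] := obj_SP c.
have [h ->] := principal_coneE T M; rewrite hom_norm_rho.
apply: opnorm_le; first exact: opnorm_ge0.
(* Projections are contractions, so [opnorm T] bounds every component at once. *)
move=> x /=; rewrite (le_trans (ler_opnorm T _))// ler_wpM2l ?opnorm_ge0//.
exact: orthproj_contract.
Qed.

Definition principal_bncone T : bncone H :=
  BNCone (@principal_cone_is_cone _ _ _ T) (@principal_cone_is_normal _ _ _ T)
    (principal_cone_is_bounded T).

Lemma bncone_eq (g s : bncone H) : bncone_family g = bncone_family s -> g = s.
Proof.
case: g s => [g ? ? ?] [s ? ? ?] /= gs; subst s.
by congr BNCone; exact: Prop_irrelevance.
Qed.

Lemma bncone_principal (g : bncone H) : exists T, bncone_family g = principal_cone T.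
Proof.
case: g => -[v comp] /= gcone [c0 ciso] [alpha _ gbound].
have [N vE] := obj_SP v; subst v.
have /choice[t tP] M : exists T, exists h : in_corner (proj M) T (proj N),
    comp (SP (proj M)) = rho h by exact: hom_rho.
have tN M x : fd_set M x -> fd_set N (t M x).
  move=> Mx; have [[B tE] _] := tP M; rewrite tE; exact: orthproj_in.
have tB M x : `|t M x| <= alpha * `|x|.
  have [h compE] := tP M.
  rewrite (le_trans (ler_opnorm _ x))// ler_wpM2r//.
  by rewrite -(hom_norm_rho h) -compE.
have tsub M' M x : fd_set M' `<=` fd_set M -> fd_set M' x -> t M' x = t M x.
  move=> M'M M'x; have [h' compE'] := tP M'; have [h compE] := tP M.
  have sub : obj_set (SP (proj M')) `<=` obj_set (SP (proj M)).
    by move=> C /SP_projE CM; apply/SP_projE => z; exact: M'M.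
  (* The cone condition is an equation of morphisms; it is tested on the generator of the smaller
     ideal, at the vector [x]. *)
  pose ev (f : Defs.hom (SP (proj M')) (SP (proj N))) := \val (f (ideal_elt (proj_mem M'))) x.
  have := congr1 ev (gcone _ _ sub).
  by rewrite /ev /= compE compE' /= orthproj_fix.
(* The span of [x] lies in every subspace containing [x], so [tsub] compares this value with all
   others. *)
pose f x := t (spanned [:: x]) x.
have fE M x : fd_set M x -> f x = t M x.
  move=> Mx; apply: tsub; last exact: mem_span_head.
  move=> _ /span1P[a ->]; rewrite -[_ *: _]addr0.
  case: M Mx => _ [s /= ->] sx.
  by apply: span_lin => //; exact: Defs.span0.
have lf : linear f.
  (* Linearity involves two vectors only, so it can be read off a single [t M]. *)
  move=> a x y; pose M := spanned [:: x; y].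
  have Mx : fd_set M x by exact: mem_span_head.
  have My : fd_set M y by apply: mem_span_tail; exact: mem_span_head.
  by rewrite !(fE M)//; [exact: finop_linear|exact: span_lin].
have fN x : fd_set N (f x) by apply: tN; exact: mem_span_head.
have rf : finite_dim (range f).
  by apply: (finite_rank_lin lf (fdP N)) => _ [x _ <-].
pose T := FinOp lf (ex_intro _ alpha (fun x => tB _ x)) rf.
have compE (c : obj H) (A : c) : \val (comp c A) = \val A *o T.
  move: A; have [M ->] := obj_SP c => A; have [h ->] := tP M.
  by apply: finopP => x /=; rewrite -fE//; exact: SP_val.
exists T; apply: cone_eq_principal => //.
congr (SP (proj _)); apply: fdsubspace_eq.
(* The inverse [u] of the invertible component sends [proj N] to an operator [C] with
   [C *o T = proj N]; thus [y = T (C y)] for [y] in [N]. *)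
have [u [_ uc]] := ciso.
apply/seteqP; split=> [y Ny|_ [x _ <-]//].
exists (\val (u (ideal_elt (proj_mem N))) y) => //.
have := congr1 (fun f : Defs.hom _ _ => \val (f (ideal_elt (proj_mem N))) y) uc.
by rewrite /= compE /= orthproj_fix.
Qed.

End BoundedCones.

Theorem theorem5p2 (R : realType) (k : ground)
    (H : hilbertType (@scalar_conj R k)) :
  exists prho : finop H -> bncone H,
    [/\ forall T : finop H, bncone_family (prho T) = principal_cone T,
        forall g : bncone H, exists! T : finop H,
          bncone_family g = principal_cone T
      & exists o : alg_ops (scalars R k) (bncone H),
          [/\ forall (g s : bncone H) (p : cone_family H),
                is_cone_product g s p <-> p = bncone_family (amul o g s),
              forall T1 T2 : finop H,
                aadd o (prho T1) (prho T2) = prho (T1 + T2),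
              forall (a : scalars R k) (T : finop H),
                ascale o a (prho T) = prho (a *: T),
              forall T : finop H, anorm o (prho T) = opnorm T
            & is_normed_algebra o /\
              exists f : finop H -> bncone H,
                normed_algebra_iso (finop_ops H) o f]].
Proof.
exists principal_bncone; split=> // [g|].
  have [T gT] := bncone_principal g; exists T; split=> // T' gT'.
  by apply: principal_cone_inj; rewrite -gT.
have [h hP] := choice (@bncone_principal R k H).
have hK : cancel h principal_bncone by move=> g; apply: bncone_eq; rewrite [RHS]hP.
have prhoK : cancel principal_bncone h.
  by move=> T; apply: principal_cone_inj; rewrite -hP.
(* With the operations carried over from [finop H], the product of cones is the only one that has to
   be compared with an independent definition. *)
exists (transport_ops (finop_ops H) principal_bncone h); split=> /=.
- by move=> g s p; rewrite !hP; exact: principal_cone_product.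
- by move=> T1 T2; rewrite !prhoK.
- by move=> a T; rewrite prhoK.
- by move=> T; rewrite prhoK.
- split; first exact: transport_normed_algebra finop_normed_algebra.
  exists principal_bncone; split=> /= *; rewrite ?prhoK//.
  by exists h.
Qed.
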